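(* Let $(G,\mathfrak{B})$ be a contracting finitely generated self-replicating self-similar group, and let $\mathsf{X}$ be a basis of $\mathfrak{B}$. Then the topological (covering) dimension of the limit space $\mathcal{J}_G$ is equal to the asymptotic dimension of every orbital graph $\Gamma_w$, $w\in\mathsf{X}^\omega$, of the action of $G$ on $\mathsf{X}^\omega$.
   Context: A self-similar group $(G,\mathfrak{B})$ is a group $G$ with a set $\mathfrak{B}$ (the biset) equipped with commuting left and right $G$-actions such that the right action is free and has finitely many orbits. It is self-replicating if the left action of $G$ on $\mathfrak{B}$ is transitive. A basis $\mathsf{X}\subset\mathfrak{B}$ is a set meeting every right orbit exactly once. For $g\in G$ and $x\in\mathsf{X}$ there are unique $g(x)\in\mathsf{X}$ and $g|_x\in G$ with $g\cdot x=g(x)\cdot g|_x$. This extends to an action of $G$ on the set $\mathsf{X}^*=\bigcup_{n\ge0}\mathsf{X}^n$ of finite words by $g(xv)=g(x)\,g|_x(v)$, with sections $g|_{v_1v_2}=(g|_{v_1})|_{v_2}$, and to an action on the space $\mathsf{X}^\omega$ of right-infinite sequences. $(G,\mathfrak{B})$ is contracting if for some (equivalently, every) basis there is a finite set $\mathcal{N}\subset G$ such that for every $g\in G$ there is $n$ with $g|_v\in\mathcal{N}$ for all words $v$ of length at least $n$; the smallest such set $\mathcal{N}$ is the nucleus (with respect to the basis). Limit space: let $\mathsf{X}^{-\omega}$ be the space of left-infinite sequences $\ldots x_2x_1$ over $\mathsf{X}$ with the product topology. $\mathcal{J}_G$ is the quotient of $\mathsf{X}^{-\omega}$ by the equivalence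 relation identifying $\ldots x_2x_1$ with $\ldots y_2y_1$ if there is a sequence $g_n$ of elements of the nucleus with $g_n(x_n\ldots x_2x_1)=y_n\ldots y_2y_1$ for all $n$. The orbital graph $\Gamma_w$ has vertex set equal to the $G$-orbit of $w$, two vertices being connected by an edge if and only if they are of the form $g(w)$, $hg(w)$ with $g\in G$, $h\in\mathcal{N}$; it is considered with its combinatorial graph metric. A metric space has asymptotic dimension at most $d$ if for every $R\ge0$ there is a cover $\mathcal{U}$ by sets of uniformly bounded diameter such that every set of diameter at most $R$ intersects at most $d+1$ elements of $\mathcal{U}$. *)

(* Defs.v *)
From HB Require Import structures.
From mathcomp Require Import all_boot all_order all_algebra.
From mathcomp Require Import all_classical all_reals all_analysis.

Set Implicit Arguments.
Unset Strict Implicit.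
Unset Printing Implicit Defensive.

Import Order.TTheory GRing.Theory Num.Theory.
Local Open Scope classical_set_scope.
Local Open Scope group_scope.

(* A self-similar group (G, B) is a group G with a carrier B of this type. *)
HB.mixin Record isBiset (G : groupType) B & Choice B := {
  lact : G -> B -> B;
  ract : B -> G -> B;
  lact1 : forall b, lact 1 b = b;
  lactM : forall g h b, lact (g * h) b = lact g (lact h b);
  ract1 : forall b, ract b 1 = b;
  ractM : forall b g h, ract b (g * h) = ract (ract b g) h;
  lractA : forall g b h, ract (lact g b) h = lact g (ract b h);
  ract_free : forall b g, ract b g = b -> g = 1;
  finite_right_orbits : finite_set (range (fun b => range (ract b)))
}.

#[short(type="bisetType")]
HB.structure Definition Biset (G : groupType) := {B of isBiset G B & Choice B}.

Definition right_orbit (G : groupType) (B : bisetType G) (b : B) : set B :=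
  range (ract b).

Definition self_replicating (G : groupType) (B : bisetType G) : Prop :=
  forall b c : B, exists g : G, lact g b = c.

Definition finitely_generated (G : groupType) : Prop :=
  exists2 S : set G, finite_set S &
    smallest [set H : set G | group_closed [in H]] S = setT.

Definition is_basis (G : groupType) (B : bisetType G) (X : set B) : Prop :=
  forall b, exists! x, (X `&` right_orbit b) x.

Record bisetBasis (G : groupType) (B : bisetType G) := Basis {
  basis_set :> set B;
  basisP : is_basis basis_set
}.

Section Coordinates.
Context {G : groupType} {B : bisetType G}.
Implicit Types (b : B) (g h k : G).

Lemma ract_inj b : injective (ract b).
Proof.
move=> g h e; have : ract b (g * h^-1) = b.
  by rewrite ractM e -ractM divgg ract1.
by move/ract_free/divg1_eq.
Qed.

Variable X : bisetBasis B.

Lemma coordinates_ex b : exists p : X * G, b = ract (val p.1) p.2.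
Proof.
have [x [[Xx [g _ bgx]] _]] := basisP X b.
exists (exist _ x (mem_set Xx), g^-1) => /=.
by rewrite -bgx -ractM divgg ract1.
Qed.

Definition coord b : X := (projT1 (cid (coordinates_ex b))).1.
Definition coef b : G := (projT1 (cid (coordinates_ex b))).2.

Lemma coordE b : b = ract (val (coord b)) (coef b).
Proof. exact: projT2 (cid (coordinates_ex b)). Qed.

Lemma coord_uniq b (x : X) g :
  b = ract (val x) g -> coord b = x /\ coef b = g.
Proof.
move=> bx; have /esym e := coordE b.
have xx : coord b = x.
  have [y [_ yP]] := basisP X b.
  have coset z h : basis_set X z -> b = ract z h ->
      (basis_set X `&` right_orbit b) z.
    by move=> Xz ->; split=> //; exists h^-1; rewrite // -ractM divgg ract1.
  apply: val_inj; transitivity y.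
    by apply/esym/yP/coset/coordE; exact: set_mem (valP (coord b)).
  by apply/yP; apply: coset bx; exact: set_mem (valP x).
split=> //; apply: (@ract_inj (val x)); by rewrite -{1}xx e.
Qed.

Lemma finite_letters : finite_set [set: X].
Proof.
rewrite (_ : setT = (fun x : X => range (ract (val x))) @^-1`
                    range (fun b : B => range (ract b))).
  apply: finite_preimage finite_right_orbits => x y _ _ /= e.
  have : range (ract (val x)) (val y) by rewrite e; exists 1; rewrite ?ract1.
  case=> g _ xg; have xy : val x = ract (val y) g^-1.
    by rewrite -xg -ractM divgg ract1.
  have [<- _] := coord_uniq xy.
  by have [-> _] := @coord_uniq (val x) x 1 (esym (ract1 _)).
by apply/seteqP; split=> // x _; exists (val x).
Qed.

(* g(x) and g|_x *)
Definition letter_act g (x : X) : X := coord (lact g (val x)).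
Definition letter_sec g (x : X) : G := coef (lact g (val x)).

Fixpoint word_act g (v : seq X) : seq X :=
  if v is x :: v' then letter_act g x :: word_act (letter_sec g x) v'
  else [::].

Definition word_sec g (v : seq X) : G := foldl letter_sec g v.

(* A function w : nat -> X stands for the right-infinite word w_0 w_1 w_2 ... *)
Definition seq_act g (w : nat -> X) : nat -> X :=
  fun n => letter_act (word_sec g (mkseq w n)) (w n).

Definition absorbing (N : set G) : Prop :=
  finite_set N /\
  forall g, exists n, forall v : seq X, (n <= size v)%N -> N (word_sec g v).

Definition contracting_basis : Prop := exists N, absorbing N.

(* This is the smallest absorbing set as soon as there is one, see
   nucleus_absorbing. *)
Definition nucleus : set G := smallest absorbing set0.

Lemma letterE g x :
  lact g (val x) = ract (val (letter_act g x)) (letter_sec g x).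
Proof. exact: coordE. Qed.

Lemma letter1 x : letter_act 1 x = x /\ letter_sec 1 x = 1.
Proof. by apply: coord_uniq; rewrite lact1 ract1. Qed.

Lemma letterM g h x :
  letter_act (g * h) x = letter_act g (letter_act h x) /\
  letter_sec (g * h) x = letter_sec g (letter_act h x) * letter_sec h x.
Proof. by apply: coord_uniq; rewrite lactM letterE -lractA letterE ractM. Qed.

Lemma size_word_act g v : size (word_act g v) = size v.
Proof. by elim: v g => //= x v IH g; rewrite IH. Qed.

Lemma word_act1 v : word_act 1 v = v.
Proof. by elim: v => //= x v IH; have [-> ->] := letter1 x; rewrite IH. Qed.

Lemma word_sec1 v : word_sec 1 v = 1.
Proof.
by rewrite /word_sec; elim: v => //= x v IH; have [_ ->] := letter1 x.
Qed.

Lemma word_actM g h v : word_act (g * h) v = word_act g (word_act h v).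
Proof.
by elim: v g h => //= x v IH g h; have [-> ->] := letterM g h x; rewrite IH.
Qed.

Lemma word_secM g h v :
  word_sec (g * h) v = word_sec g (word_act h v) * word_sec h v.
Proof.
rewrite /word_sec; elim: v g h => //= x v IH g h.
by have [_ ->] := letterM g h x; rewrite IH.
Qed.

Lemma word_actK g v : word_act g^-1 (word_act g v) = v.
Proof. by rewrite -word_actM mulVg word_act1. Qed.

Lemma word_secV g v : word_sec g^-1 (word_act g v) = (word_sec g v)^-1.
Proof.
have /divg1_eq <- : word_sec g^-1 (word_act g v) / (word_sec g v)^-1 = 1 => //.
by rewrite invgK -word_secM mulVg word_sec1.
Qed.

Lemma word_act_cat g u v :
  word_act g (u ++ v) = word_act g u ++ word_act (word_sec g u) v.
Proof. by elim: u g => //= x u IH g; rewrite IH. Qed.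

Lemma word_sec_cat g u v : word_sec g (u ++ v) = word_sec (word_sec g u) v.
Proof. exact: foldl_cat. Qed.

Lemma absorbing_finite N (s : seq G) : absorbing N ->
  exists n, forall g, g \in s ->
    forall v : seq X, (n <= size v)%N -> N (word_sec g v).
Proof.
move=> [_ NP]; elim: s => [|g s [n IH]]; first by exists 0%N.
have [m mP] := NP g; exists (maxn m n) => h.
rewrite inE => /orP[/eqP ->|hs] v; rewrite geq_max => /andP[mv nv].
  exact: mP.
exact: IH nv.
Qed.

Lemma nucleus_absorbing : contracting_basis -> absorbing nucleus.
Proof.
move=> [N Nabs]; have [Nfin NP] := Nabs.
have subN : nucleus `<=` N by apply: smallest_sub.
split; first exact: sub_finite_set subN Nfin.
move=> g; have [s Ns] := (finite_seqP N).1 Nfin.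
suff [n nP] : exists n, forall h, h \in s -> ~ nucleus h ->
    forall v : seq X, (n <= size v)%N -> word_sec g v <> h.
  have [m mP] := NP g; exists (maxn m n) => v.
  rewrite geq_max => /andP[/mP gvN nv]; apply: contrapT => gv.
  by apply: (nP _ _ gv v nv) => //; move: gvN; rewrite {1}Ns.
elim: s {Ns} => [|h s [n IH]]; first by exists 0%N.
have [hN|hN] := pselect (nucleus h).
  by exists n => k; rewrite inE => /orP[/eqP ->//|]; apply: IH.
have [M [[[Mfin MP] _] Mh]] :
    exists M, (absorbing M /\ set0 `<=` M) /\ ~ M h.
  apply: contrapT => noM; apply: hN => M [Mabs M0].
  by apply: contrapT => Mh; apply: noM; exists M.
have [m mP] := MP g; exists (maxn m n) => k.
rewrite inE => /orP[/eqP -> _|ks kN] v; rewrite geq_max => /andP[mv nv].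
  by move=> gvh; apply: Mh; rewrite -gvh; apply: mP.
exact: IH ks kN v nv.
Qed.

Lemma nucleus1 (x : X) : nucleus 1.
Proof.
move=> M [[_ MP] _]; have [n nP] := MP 1.
by rewrite -(word_sec1 (nseq n x)); apply: nP; rewrite size_nseq.
Qed.

Lemma nucleusV g : nucleus g -> nucleus g^-1.
Proof.
move=> gN M [[Mfin MP] _].
suff [h Mh <-] : ((fun h : G => h^-1) @` M) g by rewrite invgK.
apply: gN; split=> //; split; first exact: finite_image.
move=> h; have [n nP] := MP h^-1; exists n => v nv.
exists (word_sec h v)^-1; last by rewrite invgK.
by rewrite -word_secV; apply: nP; rewrite size_word_act.
Qed.

End Coordinates.

Definition contracting (G : groupType) (B : bisetType G) : Prop :=
  exists X : bisetBasis B, contracting_basis X.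

Section BasisChange.
Context {G : groupType} {B : bisetType G} (X Y : bisetBasis B).
Implicit Types (g h k : G) (y : Y) (v : seq Y).

(* For y in Y, k . y = x . h with x = basis_trans k y and h = basis_shift k y. *)
Definition basis_trans k y : X := coord X (lact k (val y)).
Definition basis_shift k y : G := coef X (lact k (val y)).

Fixpoint word_trans k v : seq X :=
  if v is y :: v' then basis_trans k y :: word_trans (basis_shift k y) v' else [::].
Definition word_shift k v : G := foldl basis_shift k v.

Lemma size_word_trans k v : size (word_trans k v) = size v.
Proof. by elim: v k => //= y v IH k; rewrite IH. Qed.

Lemma transE k y : lact k (val y) = ract (val (basis_trans k y)) (basis_shift k y).
Proof. exact: coordE. Qed.

Lemma word_sec_conj g k k' v :
  word_sec (k' * g * k^-1) (word_trans k v) =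
  word_shift k' (word_act g v) * word_sec g v * (word_shift k v)^-1.
Proof.
rewrite /word_sec /word_shift; elim: v g k k' => //= y v IH g k k'.
rewrite -IH; congr foldl.
have e : lact (k' * g * k^-1) (val (basis_trans k y)) =
    ract (val (basis_trans k' (letter_act g y)))
      (basis_shift k' (letter_act g y) * letter_sec g y * (basis_shift k y)^-1).
  have -> : val (basis_trans k y) = ract (lact k (val y)) (basis_shift k y)^-1.
    by rewrite transE -ractM divgg ract1.
  rewrite -lractA -lactM -mulgA mulVg mulg1 lactM letterE -lractA transE.
  by rewrite !ractM.
exact: (coord_uniq e).2.
Qed.

Lemma word_shiftM g k v :
  word_shift (g * k) v = word_sec g (word_trans k v) * word_shift k v.
Proof.
rewrite /word_sec /word_shift; elim: v g k => //= y v IH g k.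
rewrite -IH; congr foldl.
suff e : lact (g * k) (val y) =
    ract (val (letter_act g (basis_trans k y)))
      (letter_sec g (basis_trans k y) * basis_shift k y) by exact: (coord_uniq e).2.
by rewrite lactM transE -lractA letterE ractM.
Qed.


Fixpoint products (D : set G) n : set G :=
  if n is n'.+1 then [set d * p | d in D & p in products D n'] else [set 1].

Lemma finite_products D n : finite_set D -> finite_set (products D n).
Proof.
by move=> Dfin; elim: n => [|n IH] /=; [exact: finite_set1|exact: finite_image2].
Qed.

Lemma productsD D m n g h :
  products D m g -> products D n h -> products D (m + n) (g * h).
Proof.
elim: m g => [|m IH] g; first by move=> ->; rewrite mul1g.
move=> [d Dd [p pP <-]] hP; rewrite addSn -mulgA.
by exists d => //; exists (p * h) => //; apply: IH.
Qed.

Lemma products1 D d : D d -> products D 1 d.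
Proof. by move=> Dd; exists d => //; exists 1; rewrite ?mulg1. Qed.

Lemma products_mono D m n : D 1 -> (m <= n)%N ->
  products D m `<=` products D n.
Proof.
move=> D1 /subnK <-; elim: (n - m)%N => [|k IH] g; first by [].
move=> /IH gP.
by rewrite addSn; exists 1 => //; exists g; rewrite ?mul1g.
Qed.

Lemma sections_finite N (A : set G) : absorbing X N -> finite_set A ->
  finite_set [set word_sec g v | g in A & v in [set: seq X]].
Proof.
move=> Nabs /finite_seqP[s As]; have [n nP] := absorbing_finite s Nabs.
pose S i := [set word_sec g v | g in A & v in [set v : seq X | size v = i]].
have Sfin i : finite_set (S i).
  elim: i => [|i IH].
    apply: (@sub_finite_set _ _ A); last by rewrite As; exact: finite_seq.
    by move=> _ [g Ag [[|//] _ <-]].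
  apply: (@sub_finite_set _ _
    [set letter_sec h x | h in S i & x in [set: X]]).
    move=> _ [g Ag [v vi <-]]; case/lastP: v vi => [//|v x] /=.
    rewrite size_rcons => -[vi]; exists (word_sec g v).
      by exists g => //; exists v.
    by exists x => //; rewrite /word_sec foldl_rcons.
  exact: finite_image2 IH (finite_letters X).
apply: (@sub_finite_set _ _ (N `|` \bigcup_(i in `I_n) S i)).
  move=> _ [g Ag [v _ <-]]; have [nv|vn] := leqP n (size v).
    by left; apply: nP nv; move: Ag; rewrite As.
  by right; exists (size v) => //; exists g => //; exists v.
by rewrite finite_setU; split; [exact: Nabs.1|exact: bigcup_finite].
Qed.

Lemma word_shift_finite : contracting_basis X ->
  exists2 F : set G, finite_set F & forall v, F (word_shift 1 v).
Proof.
move=> [N Nabs].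
pose A : set G := 1 |` ([set basis_shift 1 y | y in [set: Y]] `|` N).
pose D : set G := [set word_sec g v | g in A & v in [set: seq X]].
have Dfin : finite_set D.
  apply: (sections_finite Nabs); rewrite !finite_setU; split.
    exact: finite_set1.
  by split; [exact: finite_image (finite_letters Y)|exact: Nabs.1].
have ND : N `<=` D by move=> g Ng; exists g; [right; right|exists [::]].
have D1 : D 1 by exists 1; [left|exists [::]].
have Dshift y : D (basis_shift 1 y).
  by exists (basis_shift 1 y); [right; left; exists y|exists [::]].
have Dsec d (v : seq X) : D d -> D (word_sec d v).
  by move=> [g Ag [u _ <-]]; exists g => //; exists (u ++ v) => //;
     rewrite word_sec_cat.
have Psec n g (v : seq X) : products D n g -> products D n (word_sec g v).
  elim: n g v => [|n IH] g v /=; first by move=> ->; rewrite word_sec1.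
  move=> [d Dd [p pP <-]]; rewrite word_secM.
  by exists (word_sec d (word_act p v)); [exact: Dsec|
     exists (word_sec p v) => //; exact: IH].
have shift1P v : products D (size v) (word_shift 1 v).
  elim/last_ind: v => [|v y IH] //.
  rewrite size_rcons -addn1 /word_shift foldl_rcons -/(word_shift 1 v).
  have := word_shiftM (word_shift 1 v) 1 [:: y].
  rewrite mulg1 /= => ->; apply: productsD; last exact: products1.
  exact: (Psec _ _ [:: _]).
have [s Ds] := (finite_seqP D).1 Dfin.
have [m mP] := absorbing_finite [seq d * e | d <- s, e <- s] Nabs.
pose M := m.+1.
have DD d e (v : seq X) : D d -> D e -> size v = M -> D (word_sec (d * e) v).
  move=> Dd De vM; apply/ND/mP; last by rewrite vM.
  by apply: allpairs_f; [move: Dd|move: De]; rewrite {1}Ds.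
have Phalf j g (v : seq X) : size v = M -> products D j.*2.+1 g ->
    products D j.+1 (word_sec g v).
  elim: j g v => [|j IH] g v vM; first exact: Psec.
  rewrite doubleS => -[d Dd [_ [e De [p pP <-]] <-]].
  rewrite mulgA word_secM; exists (word_sec (d * e) (word_act p v)).
    by apply: DD => //; rewrite size_word_act.
  by exists (word_sec p v) => //; exact: IH.
have Pblock g v : size v = M -> products D M.*2.+1 g ->
    products D M.*2.+1 (word_shift g v).
  move=> vM gP; rewrite -[g in word_shift g]mulg1 word_shiftM.
  rewrite -addnn -addSn; apply: productsD; last by rewrite -{1}vM.
  by apply: Phalf => //; rewrite size_word_trans.
exists (products D (M.*2.+1 + M)); first exact: finite_products.
suff Pn n v g : products D M.*2.+1 g -> (size v < n)%N ->
    products D (M.*2.+1 + M) (word_shift g v).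
  by move=> v; apply: (Pn (size v).+1) => //; apply: (@products_mono D 0).
elim: n v g => // n IH v g gP vn.
have [vM|Mv] := ltnP (size v) M.
  rewrite -[g]mulg1 word_shiftM; apply: productsD; first exact: Psec.
  by apply: products_mono (shift1P v) => //; exact: ltnW.
rewrite -(cat_take_drop M v) /word_shift foldl_cat.
apply: IH; first by apply: Pblock => //; rewrite size_take_min; exact/minn_idPl.
rewrite size_drop -ltnS (leq_trans _ vn) // ltnS -subSn //.
by rewrite leq_subLR addSn ltnS leq_addl.
Qed.

End BasisChange.

Lemma contracting_any (G : groupType) (B : bisetType G) :
  contracting B -> forall Y : bisetBasis B, contracting_basis Y.
Proof.
move=> [X Xc] Y; have [F Ffin FP] := @word_shift_finite _ _ X Y Xc.
have [N [Nfin NP]] := Xc.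
exists [set f^-1 * p | f in F & p in [set n * h | n in N & h in F]]; split.
  by do 2! [apply: finite_image2 => //].
move=> g; have [n nP] := NP g; exists n => v nv.
exists (word_shift X 1 (word_act g v)) => //.
exists (word_sec g (word_trans X 1 v) * word_shift X 1 v).
  exists (word_sec g (word_trans X 1 v)); last by exists (word_shift X 1 v).
  by apply: nP; rewrite size_word_trans.
have := word_sec_conj X g 1 1 v; rewrite mul1g invg1 mulg1 => ->.
by rewrite -!mulgA mulVg mulg1 !mulgA mulVg mul1g.
Qed.

Section LimitSpace.
Local Open Scope quotient_scope.
Context {G : groupType} {B : bisetType G} (X : bisetBasis B).

(* a : left_seq X stands for the left-infinite word ... x_2 x_1 with
   x_(i+1) = a i, so that rev (mkseq a n) is the word x_n ... x_1. *)
Definition left_seq : topologicalType := {ptws nat -> discrete_topology X}.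

Definition asym_equiv (a b : nat -> X) : Prop :=
  exists g : nat -> G, forall n,
    nucleus X (g n) /\ word_act (g n) (rev (mkseq a n)) = rev (mkseq b n).

Lemma asym_equiv_refl a : asym_equiv a a.
Proof.
by exists (fun=> 1) => n; rewrite word_act1; split=> //; exact: nucleus1 (a 0).
Qed.

Lemma asym_equiv_sym a b : asym_equiv a b -> asym_equiv b a.
Proof.
move=> [g gP]; exists (fun n => (g n)^-1) => n; have [gN <-] := gP n.
by rewrite word_actK; split=> //; exact: nucleusV.
Qed.

Lemma mkseqD (a : nat -> X) m n :
  rev (mkseq a (m + n)) =
  rev (mkseq (fun i => a (m + i)) n) ++ rev (mkseq a m).
Proof.
rewrite -rev_cat /mkseq iotaD map_cat add0n.
by rewrite -[in iota m n](addn0 m) iotaDl -map_comp.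
Qed.

Hypothesis contr : contracting B.

Lemma asym_equiv_trans a b c :
  asym_equiv a b -> asym_equiv b c -> asym_equiv a c.
Proof.
move=> [g gP] [h hP].
have Nabs := nucleus_absorbing (contracting_any contr X).
have [s Ns] := (finite_seqP _).1 Nabs.1.
have [m mP] := absorbing_finite [seq k * l | k <- s, l <- s] Nabs.
pose P n := rev (mkseq (fun i => a (n + i)) m).
exists (fun n => word_sec (h (n + m)%N * g (n + m)%N) (P n)) => n.
have [gN gab] := gP (n + m)%N; have [hN hbc] := hP (n + m)%N; split.
  apply: mP; last by rewrite size_rev size_mkseq.
  apply: allpairs_f; by [move: hN; rewrite {1}Ns|move: gN; rewrite {1}Ns].
move: hbc; rewrite -gab -word_actM !mkseqD word_act_cat => /eqP.
rewrite eqseq_cat; last by rewrite size_word_act !size_rev !size_mkseq.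
by move=> /andP[_ /eqP].
Qed.

Definition asym_rel : rel left_seq := fun a b => `[< asym_equiv a b >].

Lemma asym_rel_refl : reflexive asym_rel.
Proof. by move=> a; apply/asboolP/asym_equiv_refl. Qed.

Lemma asym_rel_sym : symmetric asym_rel.
Proof. by move=> a b; apply/asboolP/asboolP; exact: asym_equiv_sym. Qed.

Lemma asym_rel_trans : transitive asym_rel.
Proof.
move=> b a c /asboolP ab /asboolP bc; apply/asboolP.
exact: asym_equiv_trans ab bc.
Qed.

Definition asym_equiv_rel : equiv_rel left_seq :=
  EquivRel asym_rel asym_rel_refl asym_rel_sym asym_rel_trans.

Definition limit_space : topologicalType :=
  quotient_topology {eq_quot asym_equiv_rel}.

End LimitSpace.

Section Dimensions.
Context {R : realType}.
Local Open Scope ring_scope.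
Local Open Scope ereal_scope.
Local Open Scope card_scope.

Definition covering_dim_le (T : topologicalType) (d : nat) : Prop :=
  forall U : set (set T), U `<=` open -> cover U id = setT ->
  exists V : set (set T),
    [/\ V `<=` open, cover V id = setT,
        (forall A, V A -> exists2 C, U C & A `<=` C) &
        forall x, [set A | V A /\ A x] #<= `I_d.+1].

(* The infimum is +oo if no d is suitable. The empty space gets dimension 0
   rather than -1. *)
Definition covering_dim (T : topologicalType) : \bar R :=
  ereal_inf [set d%:R%:E | d in covering_dim_le T].

(* Distances take values in \bar R because graph_dist is +oo between different
   connected components; for a finite dist this is the usual notion. *)
Definition diam (T : Type) (dist : T -> T -> \bar R) (A : set T) : \bar R :=
  ereal_sup [set dist x y | x in A & y in A].

Definition asdim_le (T : Type) (dist : T -> T -> \bar R) (d : nat) : Prop :=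
  forall r : R, (0 <= r)%R ->
  exists U : set (set T),
    [/\ cover U id = setT,
        exists D : R, forall A, U A -> diam dist A <= D%:E &
        forall S : set T, diam dist S <= r%:E ->
          [set A | U A /\ A `&` S !=set0] #<= `I_d.+1].

Definition asdim (T : Type) (dist : T -> T -> \bar R) : \bar R :=
  ereal_inf [set d%:R%:E | d in asdim_le dist].

Definition graph_dist (T : eqType) (e : rel T) (u v : T) : \bar R :=
  ereal_inf [set (size p)%:R%:E | p in [set p | path e u p /\ last u p = v]].

End Dimensions.

Section OrbitalGraph.
Context {G : groupType} {B : bisetType G} {X : bisetBasis B}.

Definition seq_orbit (w : nat -> X) : set (nat -> X) :=
  range (fun g : G => seq_act g w).

Definition orbital_edge (w : nat -> X) : rel (seq_orbit w) := fun u v =>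
  `[< exists g h : G, nucleus X h /\
      [set val u; val v] = [set seq_act g w; seq_act (h * g) w] >].

End OrbitalGraph.

Arguments orbital_edge {G B X} w _ _.

(* Main.v *)
Require Import Defs.
From mathcomp Require Import all_boot all_order all_algebra.
From mathcomp Require Import all_classical all_reals all_analysis.
From mathcomp Require Import zify.

(** Write [N] for the nucleus and [products N n] for the elements that are
    products of [n] elements of [N]. Finite generation and self-replication
    make [N] a generating set (nucleus_generates), so balls of the orbital
    graph and of the graphs of the action on words of a given length are
    given by the sets [products N n]; contraction says that [products N n]
    acts on all but the first few letters of a word through [N]. Two words of
    length [n] that differ by an element of [N] index tiles of level [n] of
    the limit space J that may meet, and a word of length [M] followed by a
    fixed tail is a vertex of the orbital graph: the orbital graph is a
    blown-up copy of a cover of J, possibly ramified because elements of G may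
    fix points. The equality of dimensions is obtained by carrying covers
    from one side to the other, for each bound d separately.

    From J to the orbital graph (coarse_dim_le_orbital_graph). A cover of J of
    multiplicity d + 1 is pulled back along the truncation to [M] letters, and
    the pulled back sets are cut into their components at scale [r]. The only
    danger is that these components are unbounded. Around a left-infinite word
    [a], consider the sections at the last [n] letters of [a] of the loops
    based there. As [n] grows these subsets of [N] decrease, so they are
    stationary between two well chosen levels, and contraction shows that
    there they are closed under products (finite_isotropy). Refining the cover
    so that each member stays near one such word confines the tails of a
    component to the orbit of a finite set (local_chain_bounded).

    From the orbital graph to J (covering_dim_le_limit_space). Asymptotic
    dimension at most d is first restated with colourings by d + 1 colours
    whose monochromatic chains are bounded (coarse_dim_colorable); in this
    form finite unions are easily handled (colorable_setU). The point is to
    colour the graph of words of length [m] with a bound independent of [m]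
    (words_colorable), although it is only a quotient of the orbital graph.
    For a word [z] let K_s(z) be the set of sections at [z] of the loops of
    length [s] based at [z]. These sets increase with [s] inside the finite
    set [N], so for one of boundedly many fast growing scales
    [s] << [s'] one has K_s(z) = K_s'(z). On the words where this happens for
    given [s] and [s'], cut into few pieces formed of remote blocks, a short
    path can be corrected by a loop of length [s] so as to have trivial
    section (word_near_loop); such a path lifts to the orbital graph, whose
    colouring can therefore be used (loop_filtration). Finally the
    monochromatic components in words of a large length [m] are replaced by
    open neighbourhoods of the unions of their tiles. *)

Set Implicit Arguments.
Unset Strict Implicit.
Unset Printing Implicit Defensive.

Import Order.TTheory GRing.Theory Num.Theory.
Local Open Scope classical_set_scope.
Local Open Scope card_scope.
Local Open Scope group_scope.

(** * Finite counting *)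

Lemma count_sub_eq (T : eqType) (s : seq T) (S S' : set T) :
  S `<=` S' ->
  (count (fun t => `[< S' t >]) s <= count (fun t => `[< S t >]) s)%N ->
  forall t, t \in s -> S' t -> S t.
Proof.
move=> SS'; elim: s => [//|x s IH] /= le t.
have sub : (count (fun t => `[< S t >]) s <= count (fun t => `[< S' t >]) s)%N.
  by apply: sub_count => y /asboolP Sy; apply/asboolP/SS'.
rewrite inE; have [S'x|S'x] := pselect (S' x); last first.
  move=> /orP[/eqP -> //|]; apply: IH.
  move: le; case: asboolP => // _; rewrite add0n; case: asboolP => [/SS'//|_].
  by rewrite add0n.
move: le; rewrite (asboolT S'x).
case: asboolP => Sx /=; last by rewrite leqNgt add0n add1n ltnS sub.
by rewrite leq_add2l => le /orP[/eqP -> //|]; apply: IH.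
Qed.

Lemma increasing_sets_stabilize (T : eqType) (s : seq T) (S : nat -> set T) :
  (forall j, S j `<=` S j.+1) ->
  exists2 j, (count (fun t => `[< S 0%N t >]) s + j <= size s)%N &
    forall t, t \in s -> S j.+1 t -> S j t.
Proof.
move=> Sincr; pose c j := count (fun t => `[< S j t >]) s.
apply: contrapT => unstable.
suff grow j : (c 0%N + j <= c j)%N.
  have := leq_trans (grow (size s).+1) (count_size _ s).
  by rewrite addnS ltnNge leq_addl.
elim: j => [|j IH]; first by rewrite addn0.
rewrite addnS ltnNge; apply/negP => cj; apply: unstable.
exists j; first exact: leq_trans IH (count_size _ _).
apply: count_sub_eq; first exact: Sincr.
exact: leq_trans cj IH.
Qed.

(** Greedy colouring: the vertices are coloured one after the other, each time
    with a colour not taken by the at most [k] neighbours. *)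
Lemma greedy_coloring (T : eqType) (nb : T -> seq T) (k : nat) (s : seq T) :
  (forall x y, x \in nb y -> y \in nb x) ->
  (forall x, size (nb x) <= k)%N ->
  exists f : T -> nat, (forall x, f x <= k)%N /\
    forall x y, x \in s -> y \in s -> y \in nb x -> f x = f y -> x = y.
Proof.
move=> nbC nbk; elim: s => [|x s [f [fk fP]]]; first by exists (fun=> 0%N).
have [xs|xs] := boolP (x \in s).
  exists f; split=> // y z; rewrite !inE => ys zs.
  by apply: fP; [case/orP: ys => // /eqP ->|case/orP: zs => // /eqP ->].
have [c ck cP] : exists2 c, (c <= k)%N & c \notin map f (nb x).
  apply: contrapT => noc.
  have : (size (iota 0 k.+1) <= size (map f (nb x)))%N.
    apply: uniq_leq_size; first exact: iota_uniq.
    move=> c; rewrite mem_iota add0n ltnS => /= ck.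
    by apply: contrapT => /negP cP; apply: noc; exists c.
  by rewrite size_iota size_map ltnNge nbk.
have cnb y : y \in nb x -> f y <> c.
  by move=> ynb fy; move/negP: cP; apply; rewrite -fy map_f.
exists (fun y => if y == x then c else f y); split.
  by move=> y; case: ifP.
move=> y z; rewrite !inE.
have [->|yx] := eqVneq y x => /= ys; have [->|zx] := eqVneq z x => //= zs.
- by move=> /cnb fz e; rewrite e in fz.
- by move=> /nbC/cnb fy e; rewrite e in fy.
- exact: fP.
Qed.

Lemma card_le_seq (T : choiceType) (A : set T) n : A #<= `I_n ->
  exists2 s : seq T, (size s <= n)%N & forall x, A x -> x \in s.
Proof.
move=> An; have Afin : finite_set A by apply: card_le_finite An _; exists n.
exists (finmap.enum_fset (fset_set A)) => [|x Ax].
  exact: geq_card_fset_set.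
by have := mem_set Ax; rewrite -(in_fset_set Afin).
Qed.

(** * Coarse dimension by colourings *)

Record coarse (T : Type) (E : nat -> T -> T -> Prop) : Prop := Coarse {
  coarse_refl : forall x, E 0%N x x;
  coarse_sym : forall n x y, E n x y -> E n y x;
  coarse_trans : forall m n x y z, E m x y -> E n y z -> E (m + n)%N x z;
  coarse_mono : forall m n x y, (m <= n)%N -> E m x y -> E n x y
}.

Section Coarse.
Context {T : Type} (E : nat -> T -> T -> Prop).

Inductive chain (P : set T) (r : nat) (x : T) : T -> Prop :=
| chain0 : P x -> chain P r x x
| chainS y z : chain P r x y -> P z -> E r y z -> chain P r x z.

(** The sets of a given colour are the [r]-components of a colour class: this
    encodes a cover of [Z] by d + 1 families of [D]-bounded sets, the members
    of each family being more than [r] apart. *)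
Definition colorable (d : nat) (Z : set T) (r D : nat) : Prop :=
  exists2 f : T -> nat, (forall x, f x <= d)%N &
    forall c x y, chain (Z `&` [set z | f z = c]) r x y -> E D x y.

Lemma chain_inl P r x y : chain P r x y -> P x.
Proof. by elim. Qed.

Lemma chain_inr P r x y : chain P r x y -> P y.
Proof. by case. Qed.

Lemma chain_trans P r x y z : chain P r x y -> chain P r y z -> chain P r x z.
Proof. by move=> xy; elim=> // u v _ xu Pv; apply: chainS. Qed.

Lemma chain_sub P Q r s x y : P `<=` Q ->
  (forall x y, P x -> P y -> E r x y -> E s x y) ->
  chain P r x y -> chain Q s x y.
Proof.
move=> PQ rs; elim=> [/PQ|u v uP IH Pv uv]; first exact: chain0.
by apply: chainS IH (PQ _ Pv) _; apply: rs => //; apply: chain_inr uP.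
Qed.

Hypothesis cE : coarse E.

Lemma chain_sym P r x y : chain P r x y -> chain P r y x.
Proof.
elim=> [|u v xu ux Pv uv]; first exact: chain0.
apply: chain_trans ux; apply: (@chainS _ _ _ v); first exact: chain0.
  exact: chain_inr xu.
exact: (coarse_sym cE uv).
Qed.

Lemma colorable_sub d (Z Z' : set T) r r' D D' :
  Z' `<=` Z -> (r' <= r)%N -> (D <= D')%N ->
  colorable d Z r D -> colorable d Z' r' D'.
Proof.
move=> ZZ rr DD [f fd fP]; exists f => // c x y /chain_sub xy.
apply: (coarse_mono cE DD); apply: (fP c); apply: xy.
  by move=> z [/ZZ].
by move=> u v _ _; apply: coarse_mono.
Qed.

(** Run through a monochromatic [r]-chain of [A `|` B]: its maximal runs
    outside [A] are [R]-bounded, so its points in [A] form a chain of steps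
    [r + R + r]. *)
Lemma colorable_setU d (A B : set T) r R D :
  colorable d B r R -> colorable d A (r.*2 + R) D ->
  colorable d (A `|` B) r (D + (r + R).*2).
Proof.
move=> [f fd fP] [g gd gP].
pose h x := if `[< A x >] then g x else f x.
exists h => [x|c x y]; first by rewrite /h; case: ifP.
pose PB := B `&` [set z | f z = c]; pose PA := A `&` [set z | g z = c].
pose P := (A `|` B) `&` [set z | h z = c].
have PAB z : P z -> PA z \/ PB z.
  rewrite /P /h => -[ABz] /=; case: asboolP => Az; first by left.
  by case: ABz => // Bz; right.
move=> xy.
suff : chain PB r x y \/ exists a1 a2, [/\ E (r + R) x a1,
    chain PA (r.*2 + R) a1 a2 &
    a2 = y \/ exists2 b, E r a2 b & chain PB r b y].
  case=> [/fP xyR|[a1 [a2 [xa1 a12 a2y]]]].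
    apply: (coarse_mono cE _ xyR).
    by lia.
  have ED := gP _ _ _ a12.
  have a2yE : E (r + R) a2 y.
    case: a2y => [<-|[b a2b /fP]]; last exact: (coarse_trans cE a2b).
    by apply: (coarse_mono cE _ (coarse_refl cE _)).
  have -> : (D + (r + R).*2 = r + R + D + (r + R))%N by lia.
  exact: (coarse_trans cE (coarse_trans cE xa1 ED) a2yE).
elim: xy => [/PAB[Ax|Bx]|u v xu IH /PAB Pv uv].
- right; exists x, x; split; [|exact: chain0|by left].
  by apply: (coarse_mono cE _ (coarse_refl cE _)).
- by left; apply: chain0.
case: Pv => [Av|Bv]; last first.
  case: IH => [xuB|[a1 [a2 [xa1 a12 a2u]]]]; first by left; apply: chainS uv.
  right; exists a1, a2; split=> //; right.
  case: a2u => [e|[b a2b bu]]; last by exists b => //; apply: chainS uv.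
  by exists v; [rewrite e|apply: chain0].
right; case: IH => [/fP xuR|[a1 [a2 [xa1 a12 a2u]]]].
  exists v, v; split; [|exact: chain0|by left].
  by rewrite addnC; apply: (coarse_trans cE _ uv).
exists a1, v; split=> //; last by left.
apply: chainS a12 Av _; case: a2u => [->|[b a2b /fP bu]].
  by apply: (coarse_mono cE _ uv) => //; rewrite -addnn -addnA leq_addr.
rewrite -addnn addnAC.
exact: (coarse_trans cE (coarse_trans cE a2b bu) uv).
Qed.

(** Adding the pieces one by one requires larger and larger scales, but all of
    them are computed from the control function [D] alone. The pieces may
    therefore depend on [smax]. *)
Lemma colorable_bigcup d n r R (D : nat -> nat) :
  exists R' smax, forall (B : set T) (Z : nat -> set T),
    colorable d B r R ->
    (forall j s, (j < n)%N -> (s <= smax)%N -> colorable d (Z j) s (D s)) ->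
    colorable d (B `|` \bigcup_(j < n) Z j) r R'.
Proof.
elim: n => [|n [R' [smax IH]]].
  exists R, 0%N => B Z Bcol _.
  apply: colorable_sub Bcol => //.
  by move=> x [//|[j /= ]]; rewrite ltn0.
exists (D (r.*2 + R') + (r + R').*2)%N, (maxn smax (r.*2 + R')).
move=> B Z Bcol Zcol.
have /colorable_setU step : colorable d (B `|` \bigcup_(j < n) Z j) r R'.
  apply: IH => // j s jn ss; apply: Zcol; first exact: leqW.
  exact: leq_trans (leq_maxl _ _).
have /step : colorable d (Z n) (r.*2 + R') (D (r.*2 + R')).
  by apply: Zcol => //; apply: leq_maxr.
apply: colorable_sub => // x [Bx|[j /= ]]; first by right; left.
rewrite ltnS leq_eqVlt => /orP[/eqP ->|jn] Zx; first by left.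
by right; right; exists j.
Qed.

(** The covering definition of the asymptotic dimension at integer scales. *)
Definition coarse_dim_le (d : nat) : Prop :=
  forall r : nat, exists U : set (set T),
    [/\ cover U id = setT,
        exists D : nat, forall A x y, U A -> A x -> A y -> E D x y &
        forall S : set T, (forall x y, S x -> S y -> E r x y) ->
          [set A | U A /\ A `&` S !=set0] #<= `I_d.+1].

(** Let S_j(x) be the set of members of a cover at distance at most [j * r]
    from [x]. These sets increase with [j], and the multiplicity of the cover
    makes two consecutive ones among the first d + 2 coincide. The colour of
    [x] is such a [j]; between [r]-close points of the same colour the set S_j
    does not change, so a monochromatic chain stays close to one member. *)
Lemma coarse_dim_colorable d : coarse_dim_le d ->
  forall r, exists D, colorable d setT r D.
Proof.
move=> dimE r; have [U [Ucov [D DP] Umult]] := dimE (d.+1 * r).*2.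
pose S j (x : T) : set (set T) :=
  [set A | U A /\ exists2 a, A a & E (j * r) x a].
have Sincr x j : S j x `<=` S j.+1 x.
  move=> A [UA [a Aa xa]]; split=> //; exists a => //.
  by apply: (coarse_mono cE _ xa); rewrite leq_mul2r leqnSn orbT.
have colP x : exists2 j, (j <= d)%N & S j.+1 x `<=` S j x.
  have : [set A | U A /\ A `&` [set y | E (d.+1 * r) x y] !=set0] #<= `I_d.+1.
    apply: Umult => y z /= xy xz.
    by rewrite -addnn; apply: (coarse_trans cE _ xz); apply: (coarse_sym cE).
  move=> /card_le_seq[s sd sP].
  have Ss j A : (j <= d.+1)%N -> S j x A -> A \in s.
    move=> jd [UA [a Aa xa]]; apply: sP; split=> //; exists a; split=> //=.
    by apply: (coarse_mono cE _ xa); rewrite leq_mul2r jd orbT.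
  have [j js stab] := increasing_sets_stabilize s (Sincr x).
  have jd : (j <= d)%N.
    have S0 : (0 < count (fun A => `[< S 0%N x A >]) s)%N.
      have : cover U id x by rewrite Ucov.
      move=> [A UA Ax]; rewrite -has_count; apply/hasP; exists A.
        by apply: (Ss 0%N) => //; split=> //; exists x => //; apply: coarse_refl.
      by apply/asboolP; split=> //; exists x => //; apply: coarse_refl.
    rewrite -ltnS; apply: leq_trans sd; apply: leq_trans js.
    by rewrite -add1n leq_add2r.
  by exists j => // A SA; apply: stab => //; apply: Ss SA.
pose f x := projT1 (cid2 (colP x)).
have fd x : (f x <= d)%N by rewrite /f; case: cid2.
have fP x : S (f x).+1 x `<=` S (f x) x by rewrite /f; case: cid2.
exists (D + (d * r).*2)%N, f => // c x y xy.
have Sxy : S c x `<=` S c y.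
  elim: xy => [A //|u v xu IH [_ fv] uv A /IH[UA [a Aa ua]]].
  rewrite -fv; apply: fP; split=> //; exists a => //.
  rewrite mulSn fv; apply: (coarse_trans cE _ ua); exact: (coarse_sym cE).
have fx : f x = c by case: (chain_inl xy).
have cd : (c <= d)%N by rewrite -fx.
have [A [UA [a Aa xa]]] : S c x !=set0.
  have : cover U id x by rewrite Ucov.
  move=> [A UA Ax]; exists A; split=> //; exists x => //.
  by apply: (coarse_mono cE _ (coarse_refl cE _)).
have [_ [b Ab yb]] : S c y A by apply: Sxy; split=> //; exists a.
have dr z t : E (c * r) z t -> E (d * r) z t.
  by apply: (coarse_mono cE) => //; rewrite leq_mul2r cd orbT.
have -> : (D + (d * r).*2 = d * r + D + d * r)%N by lia.
apply: (coarse_trans cE _ (coarse_sym cE (dr _ _ yb))).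
exact: (coarse_trans cE (dr _ _ xa) (DP A a b UA Aa Ab)).
Qed.

End Coarse.

Lemma colorable_pullback (T T' : Type) (E : nat -> T -> T -> Prop)
    (E' : nat -> T' -> T' -> Prop) (f : T -> T') d (Z : set T) r r' D :
  (forall x y, Z x -> Z y -> E r x y -> E' r' (f x) (f y)) ->
  (forall x y, Z x -> Z y -> E' D (f x) (f y) -> E D x y) ->
  colorable E' d setT r' D -> colorable E d Z r D.
Proof.
move=> up down [g gd gP]; exists (g \o f) => [x|c x y xy]; first exact: gd.
apply: down; first by case: (chain_inl xy).
  by case: (chain_inr xy).
apply: (gP c); elim: xy => [[_ gx]|u v xu IH [Zv gv] uv]; first exact: chain0.
by apply: chainS IH _ _ => //; apply: up => //; case: (chain_inr xu).
Qed.

(** * Words, sections and the nucleus *)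

Section Words.
Context {G : groupType} {B : bisetType G} {X : bisetBasis B}.
Implicit Types (g h f : G) (v z : seq X) (u : nat -> X).

(** The default value of [nth] supplies the letters after [v]. *)
Definition word_cat v u : nat -> X := fun i => nth (u (i - size v)%N) v i.

Definition shift n u : nat -> X := fun i => u (n + i)%N.

Lemma mkseq_word_cat v u : mkseq (word_cat v u) (size v) = v.
Proof.
apply: (@eq_from_nth _ (u 0%N)); rewrite size_mkseq// => i iv.
by rewrite nth_mkseq// /word_cat; apply: set_nth_default.
Qed.

Lemma shift_word_cat v u : shift (size v) (word_cat v u) = u.
Proof.
apply/funext => i; rewrite /shift /word_cat nth_default ?leq_addr//.
by rewrite addKn.
Qed.

Lemma word_cat_mkseq n u : word_cat (mkseq u n) (shift n u) = u.
Proof.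
apply/funext => i; rewrite /word_cat /shift size_mkseq.
have [iN|ni] := ltnP i n; first by rewrite nth_mkseq.
by rewrite nth_default ?size_mkseq// subnKC.
Qed.

Lemma mkseqS (T : Type) (u : nat -> T) n :
  mkseq u n.+1 = rcons (mkseq u n) (u n).
Proof. by rewrite /mkseq -addn1 iotaD map_cat cats1. Qed.

Lemma mkseq_seq_act g u n : mkseq (seq_act g u) n = word_act g (mkseq u n).
Proof.
elim: n => // n IH; rewrite !mkseqS IH -cats1 -[in RHS]cats1 word_act_cat.
by [].
Qed.

Lemma shift_seq_act g u n :
  shift n (seq_act g u) = seq_act (word_sec g (mkseq u n)) (shift n u).
Proof.
apply/funext => i; rewrite /shift /seq_act -word_sec_cat; congr letter_act.
congr word_sec; rewrite /mkseq iotaD map_cat; congr cat.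
by rewrite add0n -[in LHS](addn0 n) iotaDl -map_comp.
Qed.

Lemma seq_act_word_cat g v u :
  seq_act g (word_cat v u) = word_cat (word_act g v) (seq_act (word_sec g v) u).
Proof.
rewrite -[LHS](word_cat_mkseq (size v)) mkseq_seq_act.
by rewrite shift_seq_act mkseq_word_cat shift_word_cat.
Qed.

Lemma seq_act1 u : seq_act 1 u = u.
Proof.
by apply/funext => i; rewrite /seq_act word_sec1; have [-> _] := letter1 (u i).
Qed.

Lemma seq_actM g h u : seq_act (g * h) u = seq_act g (seq_act h u).
Proof.
apply/funext => i; rewrite /seq_act word_secM -mkseq_seq_act.
by have [-> _] := letterM (word_sec g (mkseq (seq_act h u) i))
  (word_sec h (mkseq u i)) (u i).
Qed.

Lemma seq_actK g u : seq_act g^-1 (seq_act g u) = u.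
Proof. by rewrite -seq_actM mulVg seq_act1. Qed.

Lemma finite_words n : finite_set [set v : seq X | size v = n].
Proof.
elim: n => [|n IH].
  by apply: (@sub_finite_set _ _ [set [::]]) => // v /= /size0nil.
apply: (@sub_finite_set _ _
  [set x :: v | x in [set: X] & v in [set v : seq X | size v = n]]).
  by move=> [|x v] //= [vn]; exists x => //; exists v.
exact: finite_image2 (finite_letters X) IH.
Qed.

Lemma word_transitive (repl : self_replicating B) v z f : size v = size z ->
  exists2 g, word_act g v = z & word_sec g v = f.
Proof.
elim: v z => [|x v IH] [|y z] //= => [_|[vz]]; first by exists f.
have [g gv gf] := IH z vz; have [h hx] := repl (val x) (ract (val y) g).
have [ey eg] : letter_act h x = y /\ letter_sec h x = g := coord_uniq hx.
by exists h; rewrite /word_sec /= ?ey eg ?gv.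
Qed.

End Words.

Section Nucleus.
Context {G : groupType} {B : bisetType G} {X : bisetBasis B}.
Hypothesis contr : contracting B.
Implicit Types (g h f : G) (v z : seq X) (u : nat -> X).
Local Notation N := (nucleus X).
Local Notation P := (products N).

Let Nabs : absorbing X N := nucleus_absorbing (contracting_any contr X).

(** For an absorbing set [M], the elements all of whose sections lie in [M]
    form again an absorbing set, which contains the nucleus. *)
Lemma nucleus_sec g v : N g -> N (word_sec g v).
Proof.
move=> gN M [[Mfin MP] M0].
suff /(_ v) : [set h | forall z : seq X, M (word_sec h z)] g by [].
apply: gN; split=> //; split.
  by apply: sub_finite_set Mfin => h /(_ [::]).
move=> h; have [n nP] := MP h; exists n => z nz t.
rewrite -word_sec_cat; apply: nP; rewrite size_cat.
exact: leq_trans nz (leq_addr _ _).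
Qed.

Lemma products_sec n g v : P n g -> P n (word_sec g v).
Proof.
elim: n g v => [|n IH] g v /=; first by move=> ->; rewrite word_sec1.
move=> [d Dd [p pP <-]]; rewrite word_secM.
exists (word_sec d (word_act p v)); first exact: nucleus_sec.
by exists (word_sec p v) => //; exact: IH.
Qed.

Lemma productsV n g : P n g -> P n g^-1.
Proof.
elim: n g => [|n IH] g /=; first by move=> ->; rewrite invg1.
move=> [d Dd [p pP <-]]; rewrite invgM.
by have := productsD (IH _ pP) (products1 (nucleusV Dd)); rewrite addn1.
Qed.

Lemma products_contract n :
  exists k, forall g v, P n g -> (k <= size v)%N -> N (word_sec g v).
Proof.
have [s Ps] := (finite_seqP _).1 (finite_products n Nabs.1).
have [k kP] := absorbing_finite s Nabs.
by exists k => g v Pg; apply: kP; move: Pg; rewrite Ps.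
Qed.

Hypothesis x0 : X.

Lemma products_leq m n g : (m <= n)%N -> P m g -> P n g.
Proof. by move=> mn; apply: products_mono mn _; exact: nucleus1 x0. Qed.

Lemma products_id n : P n 1.
Proof. exact: (@products_leq 0). Qed.

Hypothesis fg : finitely_generated G.
Hypothesis repl : self_replicating B.

(** Sections of generators deep enough lie in the nucleus, hence so do, up to
    products, the sections of every element at that depth; and every element
    is such a section because the biset is transitive. *)
Lemma nucleus_generates g : exists n, P n g.
Proof.
have [S Sfin genS] := fg.
have [s Ss] := (finite_seqP _).1 Sfin.
have [k kP] := absorbing_finite s Nabs.
have [h _ <-] := @word_transitive _ _ X repl (nseq k x0) (nseq k x0) g erefl.
suff : [set h | forall v, size v = k -> exists n, P n (word_sec h v)] h.
  by apply; rewrite size_nseq.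
have : setT h by [].
rewrite -genS; apply; split; last first.
  move=> a Sa v vk; exists 1%N; apply: products1.
  by apply: kP; [move: Sa; rewrite Ss|rewrite vk].
split; first by rewrite inE => v vk; exists 0%N; rewrite word_sec1.
move=> a b; rewrite !inE => aP bP v vk.
have bvk : size (word_act b^-1 v) = k by rewrite size_word_act.
have [m am] := aP _ bvk; have [n bn] := bP _ bvk.
exists (m + n)%N; rewrite word_secM; apply: productsD am _.
have := productsV bn; rewrite -word_secV.
by rewrite -word_actM divgg word_act1.
Qed.

(** Words of length [M] and elements of [products N n] are finite in number,
    and by transitivity of the biset each transport is possible. *)
Lemma transport_bound M n : exists D, forall v z f,
  size v = M -> size z = M -> P n f ->
  exists g, [/\ P D g, word_act g v = z & word_sec g v = f].
Proof.
pose Q D (t : seq X * seq X * G) := exists g,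
  [/\ P D g, word_act g t.1.1 = t.1.2 & word_sec g t.1.1 = t.2].
pose W := [set v : seq X | size v = M].
pose A : set (seq X * seq X * G) := (W `*` W) `*` P n.
have Afin : finite_set A.
  apply: finite_setX; last exact: finite_products Nabs.1.
  by apply: finite_setX; apply: finite_words.
have [s As] := (finite_seqP _).1 Afin.
suff [D DP] : exists D, forall t, t \in s -> A t -> Q D t.
  exists D => v z f vM zM fP.
  have At : A (v, z, f) by [].
  by apply: (DP (v, z, f)) => //; move: At; rewrite {1}As.
elim: s {As} => [|t s [D IH]]; first by exists 0%N.
have [At|nAt] := pselect (A t); last first.
  by exists D => t'; rewrite inE => /orP[/eqP ->|] //; apply: IH.
have [[vM zM] fP] := At.
have [g gv gf] := @word_transitive _ _ X repl t.1.1 t.1.2 t.2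
  (etrans vM (esym zM)).
have [m mP] := nucleus_generates g.
exists (maxn m D) => t'; rewrite inE => /orP[/eqP -> _|t's At'].
  by exists g; split=> //; apply: products_leq mP; apply: leq_maxl.
have [g' [g'P ? ?]] := IH _ t's At'.
by exists g'; split=> //; apply: products_leq g'P; apply: leq_maxr.
Qed.

(** * Orbits and graphs of the action *)

Definition word_near n v z : Prop := exists2 h, P n h & word_act h v = z.

Lemma word_near_coarse : coarse word_near.
Proof.
split.
- by move=> v; exists 1; rewrite ?word_act1//; apply: products_id.
- move=> n v z [h hP <-]; exists h^-1; first exact: productsV.
  by rewrite word_actK.
- move=> m n v z t [h hP <-] [k kP <-]; exists (k * h).
    by rewrite addnC; apply: productsD.
  by rewrite word_actM.
- by move=> m n v z mn [h hP <-]; exists h => //; apply: products_leq hP.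
Qed.

Definition orbit_near (w : nat -> X) n (u t : seq_orbit w) : Prop :=
  exists2 h, P n h & seq_act h (val u) = val t.

Lemma orbit_near_coarse w : coarse (@orbit_near w).
Proof.
split.
- by move=> v; exists 1; rewrite ?seq_act1//; apply: products_id.
- move=> n v z [h hP hv]; exists h^-1; first exact: productsV.
  by rewrite -hv seq_actK.
- move=> m n v z t [h hP hv] [k kP kz]; exists (k * h).
    by rewrite addnC; apply: productsD.
  by rewrite seq_actM hv.
- by move=> m n v z mn [h hP hv]; exists h => //; apply: products_leq hP.
Qed.

End Nucleus.

(** * Graph metrics *)

Section GraphMetric.
Context {R : realType}.
Local Open Scope ereal_scope.

Lemma le_fin_nat (x : \bar R) (D : R) : x <= D%:E ->
  x <= (Num.bound `|D|%R)%:R%:E.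
Proof.
move=> xD; apply: le_trans xD _; rewrite lee_fin.
by apply: le_trans (ler_norm _) (ltW _); apply: archi_boundP; apply: normr_ge0.
Qed.

Lemma asdim_le_coarse (T : Type) (dist : T -> T -> \bar R)
    (E : nat -> T -> T -> Prop) d :
  (forall n x y, dist x y <= n%:R%:E <-> E n x y) ->
  asdim_le dist d <-> coarse_dim_le E d.
Proof.
move=> dE; split=> dimE r.
  have [U [Ucov [D DP] Umult]] := dimE r%:R%R (ler0n _ _).
  exists U; split=> //.
    exists (Num.bound `|D|%R) => A x y UA Ax Ay; apply/dE/le_fin_nat.
    apply: le_trans (DP A UA); apply: ereal_sup_ubound.
    by exists x => //; exists y.
  move=> S SE; apply: Umult; apply: ge_ereal_sup => _ [x Sx [y Sy <-]].
  exact/dE/SE.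
move=> r0; have [U [Ucov [D DP] Umult]] := dimE (Num.bound `|r|%R).
exists U; split=> //.
  exists D%:R%R => A UA; apply: ge_ereal_sup => _ [x Ax [y Ay <-]].
  exact/dE/(DP A).
move=> S Sr; apply: Umult => x y Sx Sy; apply/dE/le_fin_nat.
by apply: le_trans Sr; apply: ereal_sup_ubound; exists x => //; exists y.
Qed.

Lemma graph_dist_le (T : eqType) (e : rel T) (u v : T) n :
  (graph_dist e u v : \bar R) <= n%:R%:E <->
  exists p, [/\ (size p <= n)%N, path e u p & last u p = v].
Proof.
split=> [|[p [pn pe pl]]]; last first.
  apply: (@le_trans _ _ (size p)%:R%:E); last by rewrite lee_fin ler_nat.
  by apply: ereal_inf_lbound; exists p.
move=> le; have : (graph_dist e u v : \bar R) < n.+1%:R%:E.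
  by apply: le_lt_trans le _; rewrite lte_fin ltr_nat.
move=> /ereal_inf_lt[_ [p [pe pl] <-]].
by rewrite lte_fin ltr_nat ltnS => pn; exists p.
Qed.

End GraphMetric.

Section OrbitalGraph.
Context {G : groupType} {B : bisetType G} {X : bisetBasis B}.
Hypothesis contr : contracting B.
Implicit Types (g h f : G) (v z : seq X) (w : nat -> X).
Local Notation N := (nucleus X).
Local Notation P := (products N).

(** The edges of the orbital graph are unordered: the element of the nucleus
    carrying one endpoint to the other has to be inverted in some cases. *)
Lemma orbital_edge_near w (u t : seq_orbit w) :
  orbital_edge w u t -> orbit_near 1 u t.
Proof.
move=> /asboolP[g [h [hN e]]].
have uE : [set seq_act g w; seq_act (h * g) w] (val u) by rewrite -e; left.
have tE : [set seq_act g w; seq_act (h * g) w] (val t) by rewrite -e; right.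
have gE : [set val u; val t] (seq_act g w) by rewrite e; left.
have hE : [set val u; val t] (seq_act (h * g) w) by rewrite e; right.
have near1 f : N f -> seq_act f (val u) = val t -> orbit_near 1 u t.
  by move=> fN ft; exists f => //; apply: products1.
have hh : seq_act h^-1 (seq_act (h * g) w) = seq_act g w.
  by rewrite seq_actM seq_actK.
case: uE => uE; case: tE => tE.
- case: hE => hE.
    by apply: (near1 h) => //; rewrite uE -seq_actM hE uE tE.
  by apply: (near1 h) => //; rewrite uE -seq_actM hE.
- by apply: (near1 h) => //; rewrite uE -seq_actM.
- by apply: (near1 h^-1); [exact: nucleusV|rewrite uE hh].
- case: gE => gE.
    by apply: (near1 h^-1); [exact: nucleusV|rewrite uE hh gE uE tE].
  by apply: (near1 h^-1); [exact: nucleusV|rewrite uE hh gE].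
Qed.

Lemma seq_orbit_act w g u : seq_orbit w u -> seq_orbit w (seq_act g u).
Proof. by move=> [h _ <-]; exists (g * h) => //; rewrite seq_actM. Qed.

Definition orbit_act w g (u : seq_orbit w) : seq_orbit w :=
  exist _ (seq_act g (val u)) (mem_set (seq_orbit_act g (set_mem (valP u)))).

Lemma graph_dist_near (R : realType) w n (u t : seq_orbit w) :
  ((graph_dist (orbital_edge w) u t : \bar R) <= n%:R%:E)%E <->
  orbit_near n u t.
Proof.
have N1 : N 1 := nucleus1 (w 0%N).
rewrite graph_dist_le; split.
  move=> [p [pn pe <-]]; apply: (coarse_mono (orbit_near_coarse (w 0%N) w) pn).
  elim: p u pe {pn} => [|s p IH] u /=.
    by move=> _; exists 1; rewrite ?seq_act1.
  move=> /andP[/orbital_edge_near us /IH].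
  by rewrite -add1n; apply: (coarse_trans (orbit_near_coarse (w 0%N) w) us).
move=> [h hP ht].
elim: n h t hP ht => [|n IH] h t /=.
  move=> -> ht; exists [::]; split=> //=; apply: val_inj.
  by have := ht; rewrite seq_act1.
move=> [g gN [k kP <-]] ht.
have [p [pn pe pl]] := IH k (orbit_act k u) kP erefl.
exists (rcons p t); rewrite size_rcons last_rcons rcons_path pe pl; split=> //=.
have [f _ fw] := set_mem (valP (orbit_act k u)).
apply/asboolP; exists f, g; split=> //.
by rewrite seq_actM fw /= -ht -seq_actM.
Qed.

End OrbitalGraph.

(** * The limit space *)

Section LimitSpace.
Local Open Scope quotient_scope.
Context {G : groupType} {B : bisetType G} {X : bisetBasis B}.
Local Notation L := (left_seq X).

Lemma nbhs_cylinder (a : L) n :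
  nbhs a [set b : L | forall i, (i < n)%N -> b i = a i].
Proof.
elim: n => [|n IH].
  have -> : [set b : L | forall i, (i < 0)%N -> b i = a i] = setT.
    by apply/seteqP; split.
  exact: filterT.
have an : nbhs a [set b : L | b n = a n].
  exact: (@proj_continuous nat (fun=> discrete_topology X) n a _
    (discrete_set1 (a n))).
apply: filterS (filterI an IH) => b /= [bn bi] i.
by rewrite ltnS leq_eqVlt => /orP[/eqP ->|/bi].
Qed.

Lemma compact_left_seq : compact [set: L].
Proof.
have := @tychonoff nat (fun=> discrete_topology X) (fun=> setT).
have -> : [set f : nat -> discrete_topology X |
    nat -> [set: discrete_topology X] (f 0%N)] = setT by apply/seteqP; split.
by apply=> i; apply: finite_compact; apply: finite_letters.
Qed.

(** Left-infinite words are listed from their right end, whence [rev]. *)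
Definition suffix_word (a : nat -> X) n : seq X := rev (mkseq a n).

Lemma size_suffix_word a n : size (suffix_word a n) = n.
Proof. by rewrite size_rev size_mkseq. Qed.

Lemma eq_suffix_word (a b : nat -> X) n :
  (forall i, (i < n)%N -> a i = b i) -> suffix_word a n = suffix_word b n.
Proof.
move=> ab; congr rev; apply/eq_in_map => i; rewrite mem_iota add0n => /= /ab.
by [].
Qed.

Lemma suffix_word_split (a : nat -> X) m n : (m <= n)%N ->
  suffix_word a n = suffix_word (shift m a) (n - m) ++ suffix_word a m.
Proof. by move=> mn; rewrite -{1}(subnKC mn) /suffix_word mkseqD. Qed.

Lemma cluster_left_seq (C : set L) (a : nat -> L) : closed C ->
  (forall n, C (a n)) ->
  exists2 b, C b &
    forall m n, exists2 k, (n <= k)%N & suffix_word (a k) m = suffix_word b m.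
Proof.
move=> Cclosed Ca.
have Ccomp : compact C.
  by apply: subclosed_compact Cclosed compact_left_seq _.
have [b [Cb bcl]] : C `&` cluster (a @ \oo) !=set0.
  by apply: Ccomp; exists 0%N => // n _; apply: Ca.
exists b => // m n.
have [|c [/= [k nk <-] ck]] :=
  bcl (a @` [set k | (n <= k)%N]) _ _ (nbhs_cylinder b m).
  by exists n => // k nk; exists k.
by exists k => //; apply: eq_suffix_word.
Qed.

Lemma suffix_word_drop (a : nat -> X) m n : (m <= n)%N ->
  drop (n - m) (suffix_word a n) = suffix_word a m.
Proof.
move=> mn; rewrite (suffix_word_split a mn) drop_size_cat//.
by rewrite size_suffix_word.
Qed.

Lemma word_act_suffix g (a : nat -> X) m n : (m <= n)%N ->
  drop (n - m) (word_act g (suffix_word a n)) =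
  word_act (word_sec g (suffix_word (shift m a) (n - m))) (suffix_word a m).
Proof.
move=> mn; rewrite (suffix_word_split a mn) word_act_cat drop_size_cat//.
by rewrite size_word_act size_suffix_word.
Qed.

Hypothesis contr : contracting B.
Local Notation N := (nucleus X).
Local Notation P := (products N).
Local Notation J := (limit_space X contr).

Definition adjacent n (a b : nat -> X) : Prop :=
  exists2 h, N h & word_act h (suffix_word a n) = suffix_word b n.

Lemma adjacent_leq m n a b : (m <= n)%N -> adjacent n a b -> adjacent m a b.
Proof.
move=> mn [h hN hab]; exists (word_sec h (suffix_word (shift m a) (n - m))).
  exact: nucleus_sec.
by rewrite -word_act_suffix// hab suffix_word_drop.
Qed.

Lemma asym_equiv_adjacent a b : (forall n, adjacent n a b) -> asym_equiv a b.
Proof.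
move=> ab; have /choice[g gP] : forall n, exists h,
    N h /\ word_act h (suffix_word a n) = suffix_word b n.
  by move=> n; have [h hN hab] := ab n; exists h.
by exists g.
Qed.

Definition limit_point (a : L) : J := \pi_(J) a.

Lemma limit_point_surj (x : J) : exists a, limit_point a = x.
Proof. by exists (repr x); rewrite /limit_point reprK. Qed.

Lemma limit_point_eq a b : limit_point a = limit_point b <-> asym_equiv a b.
Proof.
split=> [e|ab].
  have /eqmodP/asboolP // : a = b %[mod {eq_quot asym_equiv_rel X contr}].
  exact: e.
have : a = b %[mod {eq_quot asym_equiv_rel X contr}].
  by apply/eqmodP/asboolP.
by [].
Qed.

Lemma open_limit_space (V : set J) : open V = open (limit_point @^-1` V).
Proof. by []. Qed.

(** The image of this set in the limit space is the complement of the union of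
    the tiles of level [n] indexed by words outside [S]. Testing all
    neighbours of the tile of some level [m] makes it at the same time open
    and saturated. *)
Definition inner (S : set (seq X)) n : set L :=
  [set a | exists2 m, (n <= m)%N &
    forall h, N h -> S (drop (m - n) (word_act h (suffix_word a m)))].

Lemma open_inner S n : open (inner S n).
Proof.
rewrite openE => a [m nm aS]; apply: filterS (nbhs_cylinder a m) => b ba.
by exists m => // h hN; rewrite (eq_suffix_word ba); apply: aS.
Qed.

(** The word [b] differs from [a] by elements of [N] at every level. At a level
    deeper than [m], the elements of [N] thus applied to [a] instead of [b]
    are products of two, but their sections at level [m] are again in [N]. *)
Lemma inner_saturated S n a b : asym_equiv a b -> inner S n a -> inner S n b.
Proof.
move=> [g gP] [m nm aS]; have [k kP] := @products_contract _ _ X contr 2.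
have [gN gab] := gP (m + k)%N.
exists (m + k)%N => [|h hN]; first exact: leq_trans nm (leq_addr _ _).
rewrite -[suffix_word b _]gab -word_actM -/(suffix_word a _).
have -> : (m + k - n = m - n + (m + k - m))%N by lia.
rewrite -drop_drop word_act_suffix ?leq_addr//; apply: aS; apply: kP.
  by apply: (@productsD _ _ 1 1); apply: products1.
by rewrite size_suffix_word addKn.
Qed.

Lemma inner_suffix S n a : inner S n a -> S (suffix_word a n).
Proof.
move=> [m nm /(_ 1)]; rewrite word_act1 suffix_word_drop//; apply.
exact: nucleus1 (a 0%N).
Qed.

Lemma sub_inner S n a :
  (forall h, N h -> S (word_act h (suffix_word a n))) -> inner S n a.
Proof. by move=> aS; exists n => // h hN; rewrite subnn drop0; apply: aS. Qed.

Definition inner_image (S : set (seq X)) n : set J := limit_point @` inner S n.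

Lemma inner_imageP S n a : inner_image S n (limit_point a) <-> inner S n a.
Proof.
split=> [[b bS /limit_point_eq ba]|aS]; last by exists a.
exact: inner_saturated ba bS.
Qed.

Lemma open_inner_image S n : open (inner_image S n).
Proof.
rewrite open_limit_space (_ : _ @^-1` _ = inner S n); first exact: open_inner.
by apply/seteqP; split=> a /inner_imageP.
Qed.

(** Words adjacent to [a] at higher and higher levels but outside [V]
    accumulate at a word outside [V], which would be equivalent to [a]. *)
Lemma open_contains_adjacent (V : set J) a : open V -> V (limit_point a) ->
  exists n, forall b, adjacent n a b -> V (limit_point b).
Proof.
rewrite open_limit_space => Vopen Va; apply: contrapT => none.
have /choice[b bP] : forall n, exists b : L,
    adjacent n a b /\ ~ V (limit_point b).
  move=> n; apply: contrapT => nob; apply: none; exists n => b ab.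
  by apply: contrapT => Vb; apply: nob; exists b.
have [c Vc bc] := @cluster_left_seq (~` (limit_point @^-1` V)) b
  (open_closedC Vopen) (fun n => (bP n).2).
apply: Vc => /=; suff /limit_point_eq <- : asym_equiv a c by [].
apply: asym_equiv_adjacent => n; have [k nk bkc] := bc n n.
have [h hN hab] := adjacent_leq nk (bP k).1.
by exists h; rewrite // -bkc.
Qed.

(** Words violating the conclusion at higher and higher levels would accumulate
    at some [c]; but a member of [U] around the point of [c] contains, by
    open_contains_adjacent, everything adjacent to some of them. *)
Lemma lebesgue_number (U : set (set J)) : U `<=` open -> cover U id = setT ->
  exists n, forall a, exists2 V, U V &
    forall b, adjacent n a b -> V (limit_point b).
Proof.
move=> Uopen Ucov; apply: contrapT => none.
have /choice[a aP] : forall n, exists a : L, forall V, U V ->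
    ~ forall b, adjacent n a b -> V (limit_point b).
  move=> n; apply: contrapT => noa; apply: none; exists n => a.
  apply: contrapT => noV; apply: noa; exists a => V UV Vb.
  by apply: noV; exists V.
have [c _ ac] := cluster_left_seq closedT (fun n => I : setT (a n)).
have : cover U id (limit_point c) by rewrite Ucov.
move=> [V UV /= Vc]; have [n nP] := open_contains_adjacent (Uopen _ UV) Vc.
have [k nk akc] := ac n n; apply: (aP k V UV) => b /(adjacent_leq nk)[h hN].
by rewrite akc => hcb; apply: nP; exists h.
Qed.

End LimitSpace.

(** * From the orbital graph to the limit space *)

Section OrbitToLimit.
Context {G : groupType} {B : bisetType G} {X : bisetBasis B}.
Hypotheses (contr : contracting B) (fg : finitely_generated G).
Hypothesis repl : self_replicating B.
Variable w : nat -> X.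
Implicit Types (g h f : G) (v z y : seq X).
Local Notation N := (nucleus X).
Local Notation P := (products N).
Let x0 : X := w 0%N.

(** The orbit contains every word of length [n] followed by the tail of [w]
    behind its first [n] letters, so that words embed in the orbital graph. *)
Lemma orbit_word_cat z : seq_orbit w (word_cat z (shift (size z) w)).
Proof.
have [g gz g1] := @word_transitive _ _ X repl (mkseq w (size z)) z 1
  (size_mkseq _ _).
exists g => //; rewrite -{1}(word_cat_mkseq (size z) w) seq_act_word_cat gz g1.
by rewrite seq_act1.
Qed.

Definition vertex z : seq_orbit w :=
  exist _ (word_cat z (shift (size z) w)) (mem_set (orbit_word_cat z)).

Lemma vertex_near_word n z y : size z = size y ->
  orbit_near n (vertex z) (vertex y) -> word_near n z y.
Proof.
move=> zy [h hP /= e]; exists h => //.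
by rewrite -{1}[z](mkseq_word_cat z (shift (size z) w)) -mkseq_seq_act e zy
  mkseq_word_cat.
Qed.

Lemma word_near_vertex n z h :
  P n h -> word_sec h z = 1 -> orbit_near n (vertex z) (vertex (word_act h z)).
Proof.
move=> hP h1; exists h => //=.
by rewrite seq_act_word_cat h1 seq_act1 size_word_act.
Qed.

(** For the ramified cover of the graph of words by the orbital graph, these
    sections are the monodromies of the loops of length [s] at [z]. *)
Definition loop_sections s z : set G :=
  [set g | exists h, [/\ P s h, word_act h z = z & word_sec h z = g]].

Lemma loop_sections_leq s t z : (s <= t)%N ->
  loop_sections s z `<=` loop_sections t z.
Proof.
move=> st g [h [hP hz hg]]; exists h; split=> //.
exact: products_leq hP.
Qed.

(** The path [h] from [z] to [y] is closed by a path [k] inside the block of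
    words that have the same letters as [z] after the first [M]; [k] is
    chosen with trivial section. The section of [h] is thus that of a loop of
    length [t + c], hence by assumption that of a loop [l] of length [s], and
    [h * l^-1] leads from [z] to [y] with trivial section. *)
Lemma word_near_loop (s t c M : nat) z y h :
  (forall g v, P t g -> (M <= size v)%N -> N (word_sec g v)) ->
  (forall u v g, size u = M -> size v = M -> P 0 g ->
    exists k, [/\ P c k, word_act k u = v & word_sec k u = g]) ->
  (M <= size z)%N -> P t h -> word_act h z = y -> drop M y = drop M z ->
  N `&` loop_sections (t + c) z `<=` loop_sections s z ->
  orbit_near (t + s) (vertex z) (vertex y).
Proof.
move=> Mcontr Mtrans Mz hP hzy yz stable.
have size_y : size y = size z by rewrite -hzy size_word_act.
have [k [kP ky k1]] : exists k,
    [/\ P c k, word_act k (take M y) = take M z & word_sec k (take M y) = 1].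
  by apply: Mtrans; rewrite ?size_takel// size_y.
have kyz : word_act k y = z.
  by rewrite -(cat_take_drop M y) word_act_cat ky k1 word_act1 yz cat_take_drop.
have ky1 : word_sec k y = 1.
  by rewrite -(cat_take_drop M y) word_sec_cat k1 word_sec1.
have [l [lP lz lh]] : loop_sections s z (word_sec h z).
  apply: stable; split; first exact: Mcontr.
  exists (k * h); rewrite word_actM word_secM hzy kyz ky1 mul1g; split=> //.
  by rewrite addnC; apply: productsD.
have lVz : word_act l^-1 z = z by rewrite -{1}lz word_actK.
have -> : y = word_act (h * l^-1) z by rewrite word_actM lVz.
apply: word_near_vertex; first by apply: productsD => //; apply: productsV.
by rewrite word_secM lVz -{2}lz word_secV lh mulgV.
Qed.

Variable d : nat.
Hypothesis orbit_colorable :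
  forall r, exists D, colorable (@orbit_near _ _ X w) d setT r D.

(** Induction on the number [i] of loop sections. If [z] has at most [i + 1] of
    them at a new scale [smax + c + s], then either it has at most [i] at
    scale [s], or the two scales have the same loop sections at [z] and
    word_near_loop applies. For the latter words, the blocks are coloured so
    that different blocks of the same colour are more than [smax] apart. The
    number of colours depends only on the nucleus, hence [smax] can be
    found before the length [M] of the blocks. *)
Lemma loop_filtration (Ns : seq G) r i : N = [set` Ns] ->
  exists s R m0, forall m, (m0 <= m)%N ->
    colorable (@word_near _ _ X) d
      [set z | size z = m /\
        (count (fun g => `[< loop_sections s z g >]) Ns <= i)%N] r R.
Proof.
move=> NsE; elim: i => [|i [s [R [m0 IH]]]].
  (* The identity is always a loop section: at stage 0 there are no words. *)
  exists 0%N, 0%N, 0%N => m _; exists (fun=> 0%N); first by [].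
  move=> c x y xyc; have [[_ x0P] _] := chain_inl xyc.
  have /negP[] : ~~ has (fun g => `[< loop_sections 0 x g >]) Ns.
    by rewrite has_count -leqNgt.
  apply/hasP; exists 1.
    by have := nucleus1 x0; rewrite NsE.
  by apply/asboolP; exists 1; rewrite word_act1 word_sec1.
have /choice[Df DfP] := orbit_colorable.
have [R' [smax RP]] := colorable_bigcup (word_near_coarse x0)
  d (size Ns).+1 r R (fun t => Df (t + s)%N).
have [M MP] := @products_contract _ _ X contr smax.
have [c cP] := transport_bound contr x0 fg repl M 0.
exists (smax + c + s)%N, R', (maxn m0 M) => m; rewrite geq_max => /andP[m0m Mm].
pose nb (u : seq X) := [seq word_act h u | h <- Ns].
have [W WP] := (finite_seqP _).1 (@finite_words _ _ X (m - M)).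
have NNs h : N h = (h \in Ns) by rewrite NsE.
have dropW z : size z = m -> drop M z \in W.
  move=> zm; have : [set v : seq X | size v = (m - M)%N] (drop M z).
    by rewrite /= size_drop zm.
  by rewrite WP.
have [f [fk fP]] : exists f : seq X -> nat, (forall x, f x <= size Ns)%N /\
    forall x y, x \in W -> y \in W -> y \in nb x -> f x = f y -> x = y.
  apply: greedy_coloring => [x y|x]; last by rewrite size_map.
  move=> /mapP[h hN ->]; apply/mapP; exists h^-1; last by rewrite word_actK.
  by rewrite -NNs; apply: nucleusV; rewrite NNs.
pose Z j := [set z | [/\ size z = m, f (drop M z) = j &
  N `&` loop_sections (smax + c + s) z `<=` loop_sections s z]].
apply: (@colorable_sub _ _ (word_near_coarse x0) _ _ _ _ _ _ _ _ _ _
  (RP _ Z (IH m m0m) _)) => //; last first.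
  move=> j t jn ts.
  apply: (@colorable_pullback _ _ _ (@orbit_near _ _ X w) vertex
    _ _ _ (t + s)%N).
  - move=> x y [xm xf xK] [ym yf yK] [h hP hxy].
    have hPs := products_leq x0 ts hP.
    apply: (@word_near_loop s t c M x y h) => //.
    + by move=> g v /(products_leq x0 ts); apply: MP.
    + by rewrite xm.
    + apply/esym; apply: fP.
      * exact: dropW.
      * exact: dropW.
      * apply/mapP; exists (word_sec h (take M x)).
          by rewrite -NNs; apply: MP; rewrite ?size_takel// xm.
        rewrite -hxy -{1}(cat_take_drop M x) word_act_cat drop_size_cat//.
        by rewrite size_word_act size_takel// xm.
      * by rewrite xf yf.
    + move=> g [gN gK]; apply: xK; split=> //; apply: loop_sections_leq gK.
      by rewrite -addnA; apply: leq_add => //; apply: leq_addr.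
  - move=> x y [xm _ _] [ym _ _]; apply: vertex_near_word.
    by rewrite xm ym.
  - exact: DfP.
move=> z [zm zi].
have [le|gt] := leqP (count (fun g => `[< loop_sections s z g >]) Ns) i.
  by left.
right; exists (f (drop M z)); first by rewrite /= ltnS.
split=> // g [gN]; have gNs : g \in Ns by rewrite -NNs.
apply: (count_sub_eq _ _ gNs); last exact: leq_trans zi gt.
by apply: loop_sections_leq; apply: leq_addl.
Qed.

Lemma words_colorable r : exists R m0, forall m, (m0 <= m)%N ->
  colorable (@word_near _ _ X) d [set z | size z = m] r R.
Proof.
have [Ns NsE] := (finite_seqP _).1
  (nucleus_absorbing (contracting_any contr X)).1.
have [s [R [m0 col]]] := loop_filtration r (size Ns) NsE.
exists R, m0 => m /col; apply: (colorable_sub (word_near_coarse x0)) => // z zm.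
by split=> //; apply: count_size.
Qed.

(** The tiles meeting those of [A] have their indices in this set. *)
Definition nucleus_star (A : set (seq X)) : set (seq X) :=
  [set v | exists2 y, A y & exists2 h, N h & word_act h y = v].

(** Colour the words of a large length [m] at scale 2, and take neighbourhoods
    of the unions of tiles of the monochromatic components. If two of the same
    colour had a common point, a tile containing it would be adjacent to both
    components, which would then be at distance 2. *)
Lemma covering_dim_le_limit_space : covering_dim_le (limit_space X contr) d.
Proof.
move=> U Uopen Ucov; have [n0 n0P] := lebesgue_number Uopen Ucov.
have [R [m0 col]] := words_colorable 2.
have [k kP] := @products_contract _ _ X contr R.+1.
pose m := maxn m0 (n0 + k).
have m0m : (m0 <= m)%N by apply: leq_maxl.
have n0km : (n0 + k <= m)%N by apply: leq_maxr.
have n0m : (n0 <= m)%N := leq_trans (leq_addr _ _) n0km.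
have [f fd fP] := col m m0m.
pose piece z := [set y |
  chain (@word_near _ _ X) ([set v | size v = m] `&` [set v | f v = f z]) 2 z y].
pose O z := @inner_image _ _ X contr (nucleus_star (piece z)) m.
have Omem z a : O z (limit_point contr a) ->
    exists2 y, piece z y & exists2 h, N h & word_act h y = suffix_word a m.
  by move=> /inner_imageP/inner_suffix.
have piece0 z : size z = m -> piece z z by move=> zm; apply: chain0.
exists (O @` [set z | size z = m]); split.
- by move=> _ [z _ <-]; apply: open_inner_image.
- apply/seteqP; split=> // x _; have [a <-] := limit_point_surj x.
  exists (O (suffix_word a m)).
    by exists (suffix_word a m) => //; apply: size_suffix_word.
  apply/inner_imageP/sub_inner => h hN; exists (suffix_word a m).
    by apply: piece0; apply: size_suffix_word.
  by exists h.
- move=> _ [z zm <-]; pose a := fun i => nth (w 0%N) (rev z) i.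
  have az : suffix_word a m = z.
    rewrite /suffix_word -[RHS]revK; congr rev.
    by rewrite -zm -(size_rev z) mkseq_nth.
  have [V UV VP] := n0P a; exists V => // x Ox.
  have [b bx] := limit_point_surj x; rewrite -bx in Ox *.
  have [y zy [h hN hy]] := Omem _ _ Ox; have [g gP gy] := fP _ _ _ zy.
  apply: VP; exists (word_sec (h * g) (suffix_word (shift n0 a) (m - n0))).
    apply: kP; first by rewrite -add1n; apply: productsD gP; apply: products1.
    by rewrite size_suffix_word leq_subRL.
  by rewrite -word_act_suffix// az word_actM gy hy suffix_word_drop.
move=> x; have [a <-] := limit_point_surj x.
pose F c := xget set0 [set A | exists z,
  [/\ size z = m, f z = c, A = O z & O z (limit_point contr a)]].
apply: (@card_le_trans _ _ _ (F @` `I_d.+1)); last exact: card_image_le.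
apply: subset_card_le => _ [[z zm <-] Oz].
exists (f z); first by rewrite /= ltnS.
rewrite /F; case: xgetP => [A _ [z' [z'm fz' -> Oz']]|/(_ (O z))[]]; last first.
  by exists z.
have [y zy [h hN hy]] := Omem _ _ Oz.
have [y' zy' [h' h'N h'y]] := Omem _ _ Oz'.
have yy' : word_near 2 y y'.
  exists (h'^-1 * h); last by rewrite word_actM hy -h'y word_actK.
  by apply: (@productsD _ _ 1 1); apply/products1 => //; apply: nucleusV.
suff e : piece z' = piece z by rewrite /O e.
have zz' : chain (@word_near _ _ X)
    ([set v | size v = m] `&` [set v | f v = f z]) 2 z z'.
  apply: chain_trans (chain_sym (word_near_coarse x0) _).
    by apply: chainS zy _ yy'; rewrite -fz'; apply: chain_inr zy'.
  by rewrite -fz'.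
rewrite /piece fz'; apply/seteqP; split=> v /= zv.
  exact: chain_trans zz' zv.
exact: chain_trans (chain_sym (word_near_coarse x0) zz') zv.
Qed.

End OrbitToLimit.

(** * From the limit space to the orbital graph *)

Section LimitToOrbit.
Context {G : groupType} {B : bisetType G} {X : bisetBasis B}.
Hypotheses (contr : contracting B) (fg : finitely_generated G).
Hypothesis repl : self_replicating B.
Variable w : nat -> X.
Implicit Types (g h f l : G) (v z : seq X).
Local Notation N := (nucleus X).
Local Notation P := (products N).
Let x0 : X := w 0%N.

Lemma loop_sections_cat s u v : loop_sections s (u ++ v) `<=` loop_sections s v.
Proof.
move=> _ [h [hP hz <-]]; exists (word_sec h u); split.
- exact: products_sec.
- move: hz; rewrite word_act_cat => /eqP; rewrite eqseq_cat ?size_word_act//.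
  by move=> /andP[_ /eqP].
- by rewrite word_sec_cat.
Qed.

Lemma loop_sections_contract s k u v :
  (forall g v, P s g -> (k <= size v)%N -> N (word_sec g v)) ->
  (k <= size u)%N -> loop_sections s (u ++ v) `<=` loop_sections 1 v.
Proof.
move=> kP ku _ [h [hP hz <-]]; exists (word_sec h u); split.
- by apply: products1; apply: kP.
- move: hz; rewrite word_act_cat => /eqP; rewrite eqseq_cat ?size_word_act//.
  by move=> /andP[_ /eqP].
- by rewrite word_sec_cat.
Qed.

(** The sections at the last [j * k] letters of [a] of loops in [N] decrease
    with [j], so two consecutive ones coincide. The product of two loops at
    the deeper of the two levels is an element of [products N 2], and
    reading [k] letters brings it back to a loop in [N] at the other level;
    hence this set of sections is closed under products. *)
Lemma finite_isotropy : exists T, forall a : nat -> X, exists n (K : set G),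
  [/\ (n <= T)%N, K `<=` P 1, forall g h, K g -> K h -> K (g * h) &
    loop_sections 3 (suffix_word a n) `<=` K].
Proof.
have [k kP] := @products_contract _ _ X contr 3.
have [Ns NsE] := (finite_seqP _).1
  (nucleus_absorbing (contracting_any contr X)).1.
exists ((size Ns).+1 * k)%N => a.
pose K j := loop_sections 1 (suffix_word a (j * k)).
have split_a j : suffix_word a (j.+1 * k) =
    suffix_word (shift (j * k) a) k ++ suffix_word a (j * k).
  rewrite (@suffix_word_split _ _ _ a (j * k)) ?leq_mul2r ?leqnSn ?orbT//.
  by rewrite -mulnBl subSnn mul1n.
have Kdecr j : K j.+1 `<=` K j by rewrite /K split_a; apply: loop_sections_cat.
(* The sets [K j] decrease, their complements increase. *)
have [j js stab] := @increasing_sets_stabilize _ Ns (fun j => ~` K j)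
  (fun j => subsetC (Kdecr j)).
have KP1 i : K i `<=` P 1 by move=> _ [h [hP _ <-]]; apply: products_sec.
have Kstab : K j `<=` K j.+1.
  move=> g gK; apply: contrapT => gK'; apply: (stab g) => //.
  have [h hN [_ -> <-]] := KP1 _ _ gK; rewrite mulg1.
  by move: hN; rewrite {1}NsE.
exists (j.+1 * k)%N, (K j); split=> //.
- by rewrite leq_mul2r ltnS (leq_trans (leq_addl _ _) js) orbT.
- move=> _ _ /Kstab[g [gP ga <-]] /Kstab[h [hP ha <-]].
  have : loop_sections 3 (suffix_word a (j.+1 * k))
      (word_sec (g * h) (suffix_word a (j.+1 * k))).
    exists (g * h); split=> //; last by rewrite word_actM ha ga.
    apply: (@products_leq _ _ X x0 2) => //.
    exact: (@productsD _ _ 1 1).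
  rewrite word_secM ha split_a; apply: (loop_sections_contract kP).
  by rewrite size_suffix_word.
- rewrite split_a; apply: (loop_sections_contract kP).
  by rewrite size_suffix_word.
Qed.

Variable d : nat.
Hypothesis dimJ : covering_dim_le (limit_space X contr) d.
Local Notation near := (@orbit_near _ _ X w).

Definition nucleus_orbit z : set (seq X) :=
  [set v | exists2 g, N g & word_act g z = v].

(** A left-infinite word ending in u_0 ... u_(M-1); beyond these letters
    truncated subtraction repeats u_0, any other letter would do. *)
Definition reversed M (u : nat -> X) : nat -> X := fun i => u (M.-1 - i)%N.

Lemma suffix_reversed M u : suffix_word (reversed M u) M = mkseq u M.
Proof.
apply: (@eq_from_nth _ (u 0%N)); first by rewrite size_suffix_word size_mkseq.
move=> i; rewrite size_suffix_word => iM.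
rewrite nth_rev size_mkseq// !nth_mkseq//; last by lia.
by congr u; lia.
Qed.

Lemma near_adjacent M n r k (x y : seq_orbit w) :
  (forall g v, P r g -> (k <= size v)%N -> N (word_sec g v)) ->
  (n + k <= M)%N -> near r x y ->
  adjacent n (reversed M (val x)) (reversed M (val y)).
Proof.
move=> kP nkM [h hP hxy]; have nM : (n <= M)%N := leq_trans (leq_addr _ _) nkM.
exists (word_sec h (suffix_word (shift n (reversed M (val x))) (M - n))).
  by apply: kP; rewrite // size_suffix_word leq_subRL.
rewrite -word_act_suffix// suffix_reversed -mkseq_seq_act hxy -suffix_reversed.
exact: suffix_word_drop.
Qed.

(** Every point of the chain is, up to an element [g] of [N], over the tile of
    [a]. Bringing its tail back by the section of [g] gives its tail as seen
    from [a], and a step of the chain changes that one by the section of a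
    loop in [products N 3], hence by an element of [K]. *)
Lemma local_chain_bounded M r k (a : nat -> X) n (K : set G)
    (Z : set (seq_orbit w)) :
  (forall g v, P r g -> (k <= size v)%N -> N (word_sec g v)) ->
  (n + k <= M)%N -> K `<=` P 1 -> (forall g h, K g -> K h -> K (g * h)) ->
  loop_sections 3 (suffix_word a n) `<=` K ->
  (forall x, Z x -> nucleus_orbit (suffix_word a n)
    (suffix_word (reversed M (val x)) n)) ->
  forall x y : seq_orbit w, chain near Z r x y ->
  exists2 f, P 3 f & shift M (val y) = seq_act f (shift M (val x)).
Proof.
move=> kP nkM KP1 KM loopK Zn x y xy.
have nM : (n <= M)%N := leq_trans (leq_addr _ _) nkM.
set an := suffix_word a n in loopK Zn *.
pose center (u : seq_orbit w) c := exists2 g, N g &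
  word_act g an = suffix_word (reversed M (val u)) n /\
  shift M (val u) = seq_act (word_sec g an) c.
have [g gN gx] := Zn _ (chain_inl xy).
pose c := seq_act (word_sec g an)^-1 (shift M (val x)).
have secP f : N f -> P 1 (word_sec f an).
  by move=> fN; apply: products1; apply: nucleus_sec.
suff [q qK [g' g'N [_ ->]]] : exists2 q, K q & center y (seq_act q c).
  exists (word_sec g' an * (q * (word_sec g an)^-1)).
    apply: (@productsD _ _ 1 2); first exact: secP.
    apply: (@productsD _ _ 1 1); first exact: KP1.
    exact/productsV/secP.
  by rewrite !seq_actM.
elim: xy => [_|u v xu [q qK [g1 g1N [g1u cu]]] Zv [h hP huv]].
  exists 1.
    apply: loopK; exists 1; rewrite word_act1 word_sec1; split=> //.
    exact: products_id.
  by exists g => //; split=> //; rewrite seq_act1 /c -seq_actM divgg seq_act1.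
have [g2 g2N g2v] := Zn _ Zv.
pose p := suffix_word (shift n (reversed M (val u))) (M - n).
have hM : mkseq (val u) M = p ++ suffix_word (reversed M (val u)) n.
  by rewrite -suffix_reversed (suffix_word_split _ nM).
pose h' := word_sec h p.
have h'N : N h'.
  by apply: kP => //; rewrite size_suffix_word leq_subRL.
have h'uv : word_act h' (suffix_word (reversed M (val u)) n) =
    suffix_word (reversed M (val v)) n.
  rewrite /h' -word_act_suffix// suffix_reversed -mkseq_seq_act huv.
  by rewrite -suffix_reversed suffix_word_drop.
pose l := g2^-1 * (h' * g1).
have la : word_act l an = an by rewrite !word_actM g1u h'uv -g2v word_actK.
exists (word_sec l an * q).
  apply: KM => //; apply: loopK; exists l; split=> //.
  apply: (@productsD _ _ 1 2); first by apply: products1; apply: nucleusV.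
  by apply: (@productsD _ _ 1 1); apply: products1.
exists g2 => //; split=> //.
rewrite -huv shift_seq_act hM word_sec_cat -/h' cu -!seq_actM; congr seq_act.
have -> : word_sec g2 an * (word_sec l an * q) = word_sec (g2 * l) an * q.
  by rewrite word_secM la mulgA.
by rewrite /l mulgA mulgV mul1g word_secM g1u.
Qed.

(** The cover of the limit space is made of neighbourhoods of points over which
    local_chain_bounded applies. In the pulled back sets [A' C] only the
    points are kept whose [r]-balls are contained in [A' C]: a set of diameter
    at most [r] meeting [A C] is then contained in [A' C], even in one of its
    components, so that it meets at most as many members of the final cover as
    there are members of [V] around a single point. *)
Lemma coarse_dim_le_orbital_graph : coarse_dim_le near d.
Proof.
move=> r; have [T TP] := finite_isotropy.
pose good (a : nat -> X) n (K : set G) := [/\ (n <= T)%N, K `<=` P 1,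
  forall g h, K g -> K h -> K (g * h) & loop_sections 3 (suffix_word a n) `<=` K].
pose W : set (set (limit_space X contr)) := [set C | exists a n K, good a n K /\
  C = inner_image (nucleus_orbit (suffix_word a n)) n].
have Wopen : W `<=` open.
  by move=> _ [a [n [K [_ ->]]]]; apply: open_inner_image.
have Wcov : cover W id = setT.
  apply/seteqP; split=> // x _; have [a <-] := limit_point_surj x.
  have [n [K aP]] := TP a.
  exists (inner_image (nucleus_orbit (suffix_word a n)) n).
    by exists a, n, K.
  by apply/inner_imageP/sub_inner => h hN; exists h.
have [V [Vopen Vcov Vref Vmult]] := dimJ Wopen Wcov.
have [m mP] := lebesgue_number Vopen Vcov.
have [k kP] := @products_contract _ _ X contr r.
pose M := (maxn T m + k)%N.
pose A' (C : set (limit_space X contr)) : set (seq_orbit w) :=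
  [set u | C (limit_point contr (reversed M (val u)))].
pose A C : set (seq_orbit w) := [set u | forall t, near r u t -> A' C t].
pose comp C u := [set t | chain near (A' C) r u t].
have cE := orbit_near_coarse x0 w.
exists [set D | exists C u, [/\ V C, A' C u & D = comp C u `&` A C]]; split.
- apply/seteqP; split=> // u _; have [C VC CP] := mP (reversed M (val u)).
  have AC : A C u.
    move=> t ut; apply: CP; apply: near_adjacent ut => //; first exact: kP.
    by rewrite leq_add2r leq_maxr.
  have A'C : A' C u by apply: AC; apply: (coarse_mono cE _ (coarse_refl cE u)).
  exists (comp C u `&` A C); first by exists C, u.
  by split=> //; apply: chain0.
- have [D DP] := transport_bound contr x0 fg repl M 3.
  exists D => _ x y [C [u [VC _ ->]]] [ux _] [uy _].
  have xy := chain_trans (chain_sym cE ux) uy.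
  have [_ [a [n [K [[nT KP1 KM loopK] ->]]]] CW] := Vref C VC.
  have nkM : (n + k <= M)%N.
    by rewrite leq_add2r (leq_trans nT)// leq_maxl.
  have CN x' : A' C x' -> nucleus_orbit (suffix_word a n)
      (suffix_word (reversed M (val x')) n).
    by move=> /CW/inner_imageP/inner_suffix.
  have [f fP fxy] := local_chain_bounded kP nkM KP1 KM loopK CN xy.
  have [g [gP gxy gf]] := DP (mkseq (val x) M) (mkseq (val y) M) f
    (size_mkseq _ _) (size_mkseq _ _) fP.
  exists g => //; rewrite -(word_cat_mkseq M (val x)) seq_act_word_cat gxy gf.
  by rewrite -fxy word_cat_mkseq.
move=> S Sr; have [[s Ss]|noS] := pselect (S !=set0); last first.
  rewrite (_ : [set _ | _] = set0) ?card_ge0//.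
  by apply/seteqP; split=> // D [_ [t [_ St]]]; apply: noS; exists t.
pose F C := comp C s `&` A C.
apply: (@card_le_trans _ _ _
  (F @` [set C | V C /\ C (limit_point contr (reversed M (val s)))])).
  apply: subset_card_le => _ [[C [u [VC A'u ->]]] [t [[ut At] St]]].
  have A's : A' C s by apply: At; apply: Sr.
  have us : chain near (A' C) r u s by apply: chainS ut A's (Sr _ _ St Ss).
  exists C => //; rewrite /F; congr (_ `&` _); apply/seteqP; split=> x.
    exact: chain_trans us.
  exact: chain_trans (chain_sym cE us).
exact: card_le_trans (card_image_le _ _) (Vmult _).
Qed.

End LimitToOrbit.

Theorem theorem3p5 (R : realType) (G : groupType) (B : bisetType G)
    (contr : contracting B) (fg : finitely_generated G)
    (repl : self_replicating B) (X : bisetBasis B) (w : nat -> X) :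
  covering_dim (limit_space X contr) =
  asdim (graph_dist (orbital_edge w)) :> \bar R.
Proof.
rewrite /covering_dim /asdim; congr ereal_inf; congr image.
apply/seteqP; split=> d /= dimd.
  apply/(asdim_le_coarse _ (@graph_dist_near _ _ _ R w)).
  exact: (coarse_dim_le_orbital_graph fg repl w dimd).
apply: covering_dim_le_limit_space => //.
apply: coarse_dim_colorable; first exact: orbit_near_coarse (w 0%N) w.
exact/(asdim_le_coarse _ (@graph_dist_near _ _ _ R w)).
Qed.
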